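(* There exist a Cohen–Macaulay (Noetherian local) ring $R$ and an ideal $I$ of $R$ which is a power of a prime ideal such that $D(I)\nsubseteq\overline{I}$.
   Context: For an ideal $I$ of grade $g$, $D(I):=\mathrm{Ann}_R(\mathrm{Ext}^g_R(R/I,R))$, and $\overline{I}$ denotes the integral closure of $I$. *)

(* Defs.v *)
From HB Require Import structures.
From mathcomp Require Import all_boot all_algebra generic_quotient ring_quotient.
From mathcomp Require Import boolp classical_sets functions.
From mathcomp.multinomials Require Import freeg.

Set Implicit Arguments.
Unset Strict Implicit.
Unset Printing Implicit Defensive.

Import GRing.Theory.
Local Open Scope classical_set_scope.
Local Open Scope ring_scope.
Local Open Scope quotient_scope.

(* Submodules are boolean predicates carrying ssralg's [submodClosed]
   structure; with [boolp], every submodule given in [Prop] yields one.  The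
   ideals of R, including the improper one, are the submodules of the regular
   module R^o, whereas the library's [idealr] and [prime_idealr] are proper. *)
Notation ideal R := (submodClosed R^o).

Section Modules.
Variable R : comNzRingType.
Implicit Types A B C U V M N : lmodType R.

Definition gen_mem V (X : {pred V}) : {pred V} :=
  fun x => `[< forall W : submodClosed V, {subset X <= W} -> x \in W >].

Lemma gen_mem_closed V (X : {pred V}) : subsemimod_closed (gen_mem X).
Proof.
split; first split.
- by apply/asboolP => W _; exact: rpred0.
- move=> x y /asboolP Xx /asboolP Xy; apply/asboolP => W XW.
  by apply: rpredD; [exact: Xx | exact: Xy].
- move=> a x /asboolP Xx; apply/asboolP => W XW.
  by apply: rpredZ; exact: Xx.
Qed.

HB.instance Definition _ V (X : {pred V}) :=
  GRing.isSubmodClosed.Build R V (gen_mem X) (gen_mem_closed X).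

(* The submodule generated by X; for V = R^o, the ideal generated by X. *)
Definition gen V (X : {pred V}) : submodClosed V := gen_mem X.

Record submodule V (W : submodClosed V) :=
  Submodule { submodule_val :> V; _ : submodule_val \in W }.

HB.instance Definition _ V W := [isSub for @submodule_val V W].
HB.instance Definition _ V W := [Choice of @submodule V W by <:].
HB.instance Definition _ V (W : submodClosed V) :=
  GRing.SubChoice_isSubLmodule.Build R V (fun x => x \in W) (submodule W)
    (GRing.subsemimodClosedP W).

(* [submodClosed] does not inherit from [zmodClosed], which the library's
   quotients require. *)
Definition zmod_mem V (W : submodClosed V) : {pred V} := fun x => x \in W.

Lemma zmod_mem_closed V (W : submodClosed V) : zmod_closed (zmod_mem W).
Proof. exact: (GRing.submod_closedB (GRing.submodClosedP W)). Qed.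

HB.instance Definition _ V (W : submodClosed V) :=
  GRing.isZmodClosed.Build V (zmod_mem W) (zmod_mem_closed W).

Section Quotient.
Variables (V : lmodType R) (W : submodClosed V).

Definition quotient_mod := {ideal_quot (zmod_mem W)}.

HB.instance Definition _ := GRing.Zmodule.on quotient_mod.

Definition quotient_proj (v : V) : quotient_mod := \pi_({ideal_quot (zmod_mem W)}) v.

Definition quotient_scale (a : R) (u : quotient_mod) : quotient_mod :=
  quotient_proj (a *: repr u).

Lemma quotient_projP (x y : V) :
  quotient_proj x = quotient_proj y <-> x - y \in W.
Proof. by split=> [/eqP|xy]; [|apply/eqP]; rewrite -Quotient.idealrBE. Qed.

Lemma quotient_reprK (u : quotient_mod) : quotient_proj (repr u) = u.
Proof. exact: reprK. Qed.

Lemma quotient_projD (x y : V) :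
  quotient_proj (x + y) = quotient_proj x + quotient_proj y.
Proof. by rewrite /quotient_proj Quotient.pi_add. Qed.

Lemma quotient_scale_proj (a : R) (v : V) :
  quotient_scale a (quotient_proj v) = quotient_proj (a *: v).
Proof.
apply/quotient_projP; rewrite -scalerBr; apply: rpredZ.
by apply/quotient_projP; rewrite quotient_reprK.
Qed.

Lemma quotient_scaleA (a b : R) (u : quotient_mod) :
  quotient_scale a (quotient_scale b u) = quotient_scale (a * b) u.
Proof.
by rewrite -(quotient_reprK u) !quotient_scale_proj scalerA.
Qed.

Lemma quotient_scale1 (u : quotient_mod) : quotient_scale 1 u = u.
Proof. by rewrite -(quotient_reprK u) quotient_scale_proj scale1r. Qed.

Lemma quotient_scaleDr (a : R) : {morph quotient_scale a : u v / u + v}.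
Proof.
move=> u v; rewrite -(quotient_reprK u) -(quotient_reprK v).
by rewrite -quotient_projD !quotient_scale_proj scalerDr quotient_projD.
Qed.

Lemma quotient_scaleDl (u : quotient_mod) :
  {morph quotient_scale^~ u : a b / a + b}.
Proof.
move=> a b; rewrite -(quotient_reprK u) !quotient_scale_proj.
by rewrite scalerDl quotient_projD.
Qed.

HB.instance Definition _ := GRing.Zmodule_isLmodule.Build R quotient_mod
  quotient_scaleA quotient_scale1 quotient_scaleDr quotient_scaleDl.

End Quotient.

Definition annihilator M : set R := [set r | forall m : M, r *: m = 0].

Definition ker_mem U V (f : {linear U -> V}) : {pred U} := fun u => f u == 0.

Lemma ker_mem_closed U V (f : {linear U -> V}) : subsemimod_closed (ker_mem f).
Proof.
split; first split.
- by rewrite /in_mem /= /ker_mem linear0.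
- by move=> x y /eqP fx /eqP fy; rewrite /in_mem /= /ker_mem linearD fx fy addr0.
- by move=> a x /eqP fx; rewrite /in_mem /= /ker_mem linearZ fx /= scaler0.
Qed.

HB.instance Definition _ U V (f : {linear U -> V}) :=
  GRing.isSubmodClosed.Build R U (ker_mem f) (ker_mem_closed f).

(* The homology (ker g) / (im f) at B of A -> B -> C; only meant for
   g \o f = 0, otherwise it is (ker g) / (im f `&` ker g). *)
Definition im_mem A B C (f : {linear A -> B}) (g : {linear B -> C}) :
  {pred submodule (ker_mem g)} := fun x => `[< exists a, submodule_val x = f a >].

Lemma im_mem_closed A B C (f : {linear A -> B}) (g : {linear B -> C}) :
  subsemimod_closed (@im_mem _ _ _ f g).
Proof.
split; first split.
- by apply/asboolP; exists 0; rewrite linear0.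
- move=> x y /asboolP[u xu] /asboolP[v yv]; apply/asboolP.
  by exists (u + v); rewrite linearD -xu -yv.
- move=> a x /asboolP[u xu]; apply/asboolP.
  by exists (a *: u); rewrite linearZ -xu.
Qed.

HB.instance Definition _ A B C (f : {linear A -> B}) (g : {linear B -> C}) :=
  GRing.isSubmodClosed.Build R (submodule (ker_mem g)) (@im_mem _ _ _ f g)
    (im_mem_closed f g).

Definition homology A B C (f : {linear A -> B}) (g : {linear B -> C}) :
  lmodType R := quotient_mod (@im_mem _ _ _ f g).

Definition hom_mem U V : {pred U -> V} := fun f => `[< linear f >].

Lemma hom_mem_closed U V : subsemimod_closed (@hom_mem U V).
Proof.
split; first split.
- by apply/asboolP => a u v; rewrite /= scaler0 addr0.
- move=> f g /asboolP lf /asboolP lg; apply/asboolP => a u v.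
  by rewrite addrfctE lf lg scalerDr addrACA.
- move=> b f /asboolP lf; apply/asboolP => a u v.
  by rewrite scalrfctE lf scalerDr !scalerA mulrC.
Qed.

HB.instance Definition _ U V :=
  GRing.isSubmodClosed.Build R (U -> V) (@hom_mem U V) (hom_mem_closed U V).

Definition Hom U V := submodule (@hom_mem U V).
HB.instance Definition _ U V := GRing.Lmodule.on (Hom U V).

(* The map Hom(V, N) -> Hom(U, N) of composition with g : U -> V. *)
Lemma pullback_proof U V N (g : {linear U -> V}) (h : Hom V N) :
  submodule_val h \o g \in @hom_mem U N.
Proof.
case: h => h /= /asboolP lh; apply/asboolP => a u v /=.
by rewrite linearP lh.
Qed.

Definition pullback U V N (g : {linear U -> V}) (h : Hom V N) : Hom U N :=
  Submodule (pullback_proof g h).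

Lemma pullback_linear U V N (g : {linear U -> V}) : linear (@pullback U V N g).
Proof. by move=> a h k; apply: val_inj. Qed.

HB.instance Definition _ U V N (g : {linear U -> V}) :=
  GRing.isLinear.Build R (Hom V N) (Hom U N) _ (@pullback U V N g)
    (@pullback_linear U V N g).

(* The standard free resolution of M
     ... -> free_mod (syz M 2) -> free_mod (syz M 1) -> free_mod M -> M -> 0
   where free_mod K is the free module on the underlying set of K and
   syz M n.+1 is the kernel of the evaluation free_mod (syz M n) -> syz M n. *)
Definition free_mod M : lmodType R := {freeg M / R}.

Definition free_eval M : free_mod M -> M := fglift id.

Lemma free_evalU M (a : R) (m : M) : free_eval << a *g m >> = a *: m.
Proof. exact: liftU. Qed.

Lemma free_eval_is_additive M : additive (@free_eval M).
Proof. exact: lift_is_additive. Qed.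

HB.instance Definition _ M :=
  GRing.isAdditive.Build (free_mod M) M (@free_eval M) (@free_eval_is_additive M).

Lemma free_eval_scalable M : scalable (@free_eval M).
Proof.
move=> a u.
have -> : a *: u = \sum_(x <- dom u) << a * coeff x u *g x >> :> free_mod M by [].
rewrite raddf_sum -[u in RHS]freeg_sumE raddf_sum scaler_sumr.
by apply: eq_bigr => x _; rewrite /= /free_eval !liftU scalerA.
Qed.

HB.instance Definition _ M :=
  GRing.isScalable.Build R (free_mod M) M _ (@free_eval M) (@free_eval_scalable M).

Fixpoint syz M n : lmodType R :=
  if n is n'.+1 then submodule (ker_mem (@free_eval (syz M n'))) else M.

Definition free_res M n : lmodType R := free_mod (syz M n).

Definition free_res_d M n : free_res M n.+1 -> free_res M n :=
  fun x => submodule_val (free_eval x).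

Lemma free_res_d_linear M n : linear (@free_res_d M n).
Proof. by move=> a x y; rewrite /free_res_d linearP. Qed.

HB.instance Definition _ M n :=
  GRing.isLinear.Build R (free_res M n.+1) (free_res M n) _
    (@free_res_d M n) (@free_res_d_linear M n).

(* Ext^n_R(M, N) is the n-th cohomology of the complex
     0 -> Hom(free_res M 0, N) -> Hom(free_res M 1, N) -> ... *)
Definition ext_d M N n :
  {linear Hom (free_res M n) N -> Hom (free_res M n.+1) N} :=
  @pullback _ _ N (@free_res_d M n).

Definition Ext n M N : lmodType R :=
  if n is n'.+1 then homology (ext_d M N n') (ext_d M N n'.+1)
  else submodule (ker_mem (ext_d M N 0)).

End Modules.

Section Ideals.
Variable R : comNzRingType.

Definition noetherian :=
  forall I : ideal R, exists s : seq R, I =i gen (mem s : {pred R^o}).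

Definition maximal_ideal (m : idealr R) :=
  forall J : idealr R, {subset m <= J} -> J =i m.

Definition local_with (m : idealr R) :=
  maximal_ideal m /\ forall m' : idealr R, maximal_ideal m' -> m' =i m.

(* A strict chain P 0 < ... < P d; the values of P beyond d are irrelevant. *)
Definition prime_chain (d : nat) (P : nat -> prime_idealr R) :=
  forall i, (i < d)%N ->
    {subset P i <= P i.+1} /\ exists2 x, x \in P i.+1 & x \notin P i.

Definition is_krull_dim (d : nat) :=
  (exists P, prime_chain d P) /\
  forall e P, prime_chain e P -> (e <= d)%N.

Definition regular_seq (s : seq R) :=
  (forall i, (i < size s)%N -> forall r : R,
     let J : ideal R := gen (mem (take i s) : {pred R^o}) in
     s`_i * r \in J -> r \in J) /\
  1 \notin gen (mem s : {pred R^o}).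

(* The maximal length g of an R-regular sequence in I; when I is the maximal
   ideal of a local ring, g is the depth of R. *)
Definition is_grade (I : {pred R}) (g : nat) :=
  (exists s, [/\ regular_seq s, {subset s <= I} & size s = g]) /\
  forall s, regular_seq s -> {subset s <= I} -> (size s <= g)%N.

Definition cohen_macaulay_local :=
  noetherian /\
  exists2 m : idealr R, local_with m &
    exists d, is_krull_dim d /\ is_grade m d.

Definition ideal_pow (I : {pred R}) (n : nat) : ideal R :=
  gen ((fun x => `[< exists2 a : 'I_n -> R,
    forall i, a i \in I & x = \prod_i a i >]) : {pred R^o}).

Definition prime_power (I : ideal R) :=
  exists (P : prime_idealr R) (n : nat), (0 < n)%N /\ I =i ideal_pow P n.

Definition integral_closure (I : ideal R) : set R :=
  [set x | exists (n : nat) (a : nat -> R),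
    [/\ (0 < n)%N,
        forall i, (0 < i <= n)%N -> a i \in ideal_pow (I : {pred R}) i &
        x ^+ n + \sum_(1 <= i < n.+1) a i * x ^+ (n - i) = 0]].

(* [is_grade I] determines g. *)
Definition D (I : ideal R) : set R :=
  [set r | exists2 g, is_grade I g &
    annihilator (Ext g (quotient_mod I) R^o) r].

End Ideals.

(* Main.v *)
From HB Require Import structures.
Require Import Defs.
From mathcomp Require Import all_boot all_algebra.
From mathcomp Require Import boolp classical_sets.
From mathcomp Require Import ring_quotient ring zify.
From mathcomp.multinomials Require Import freeg.
Set Implicit Arguments.
Unset Strict Implicit.
Unset Printing Implicit Defensive.

Import GRing.Theory Num.Theory.
Local Open Scope classical_set_scope.
Local Open Scope ring_scope.

(** Let V be a discrete valuation ring with uniformizer t, and let R be the ring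
    of pairs (a, b) in V * V with a = b modulo t: two copies of V glued along
    the residue field.  It is reduced, local and one-dimensional, with two
    minimal primes, the kernels of the two projections.  Let P be the kernel of
    the second projection, that is, the set of the (a, 0) with a in tV.

    Elements of P are killed by (0, t), so P ^ 2 has grade 0 and Ext is Hom:
    a linear form on R / P ^ 2 takes its values in the annihilator of P ^ 2,
    and D(P ^ 2) contains the annihilator of that annihilator
    ([Ext0_annihilator]).  As (t, 0) ^ 2 lies in P ^ 2, anything that kills
    P ^ 2 has first coordinate 0; hence (t, 0) belongs to D(P ^ 2)
    ([t_left_in_D]).  In other words D(P ^ 2) contains the second symbolic
    power of P, which is P itself because R localized at P is a field.

    Integral dependence, on the other hand, is seen by the first projection:
    it sends P ^ 2 into t ^ 2 V, so an equation of degree n for (t, 0) would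
    put t ^ n in t ^ n.+1 V ([t_left_not_integral]).

    R is Cohen-Macaulay of dimension one.  Any step in a chain of primes ends at
    the maximal ideal m ([prime_step]), which bounds the dimension.  For the
    depth, (t, t) is regular, and if x = (a, b) in m is regular then (a, 0) is
    not a multiple of x while m * (a, 0) is made of multiples of x, so that no
    second regular element exists ([fibre_depth]).  The ring V is taken to be
    the localization of the integers at 2. *)

(** * Ideals and Ext in degree zero *)

Section GeneratedIdeals.
Variable R : comNzRingType.

Lemma sub_gen (M : lmodType R) (X : {pred M}) : {subset X <= gen X}.
Proof. by move=> x Xx; apply/asboolP => W; apply. Qed.

Lemma gen_sub (M : lmodType R) (X : {pred M}) (W : submodClosed M) :
  {subset X <= W} -> {subset gen X <= W}.
Proof. by move=> XW x /asboolP; apply. Qed.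

(** Scaling in R^o is multiplication in R, but the two are not syntactically
    equal, so that closure lemmas for submodules do not apply directly. *)
Lemma idealMl (I : ideal R) (a x : R) : x \in I -> a * x \in I.
Proof. by move=> Ix; apply: (@rpredZ R R^o I a x). Qed.

Lemma idealB (I : ideal R) (x y : R) : x \in I -> y \in I -> x - y \in I.
Proof.
move=> Ix Iy; rewrite -mulN1r; apply: (@rpredD _ I) => //.
exact: (@idealMl I).
Qed.

(** The structures [idealr] and [submodClosed] are unrelated; this copy of a
    proper ideal carries the second one. *)
Definition idealr_mem (P : idealr R) : {pred R^o} := fun x => x \in P.

Lemma idealr_mem_closed (P : idealr R) : subsemimod_closed (idealr_mem P).
Proof.
split; first split; first exact: idealr0.
- by move=> x y Px Py; exact: (@rpredD _ P).
- by move=> a x; exact: (@idealMr _ P).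
Qed.

HB.instance Definition _ (P : idealr R) :=
  GRing.isSubmodClosed.Build R R^o (idealr_mem P) (idealr_mem_closed P).

Lemma ideal_pow_sub (P : idealr R) n :
  (0 < n)%N -> {subset ideal_pow P n <= P}.
Proof.
case: n => // n _; apply: (@gen_sub _ _ (idealr_mem P)) => _ /asboolP[a Pa ->].
by rewrite big_ord_recl mulrC; exact/(@idealMr _ P)/Pa.
Qed.

Lemma primeX (Q : prime_idealr R) x n : x ^+ n \in Q -> x \in Q.
Proof.
elim: n => [|n IH]; first by rewrite expr0 idealr1.
by rewrite exprS prime_idealrM => /orP[].
Qed.

Definition multiples (x : R) : {pred R^o} :=
  fun y => `[< exists c : R, y = c * x >].

Lemma multiples_closed (x : R) : subsemimod_closed (multiples x).
Proof.
split; first split.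
- by apply/asboolP; exists 0; rewrite mul0r.
- move=> _ _ /asboolP[c ->] /asboolP[d ->]; apply/asboolP.
  by exists (c + d); rewrite mulrDl.
- move=> a _ /asboolP[c ->]; apply/asboolP.
  by exists (a * c); rewrite -mulrA.
Qed.

HB.instance Definition _ (x : R) :=
  GRing.isSubmodClosed.Build R R^o (multiples x) (multiples_closed x).

Lemma mem_gen1 (x y : R) :
  y \in gen (mem [:: x] : {pred R^o}) -> exists c, y = c * x.
Proof.
move=> gy; suff: y \in multiples x by move/asboolP.
move: gy; apply: gen_sub => z; rewrite inE => /eqP ->.
by apply/asboolP; exists 1; rewrite mul1r.
Qed.

Lemma mem_gen0 (y : R) : y \in gen (mem [::] : {pred R^o}) -> y = 0.
Proof.
move=> gy; have [|c ->] := @mem_gen1 0 y; last by rewrite mulr0.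
by move: gy; apply: gen_sub.
Qed.

Lemma regular_seq_nil : regular_seq ([::] : seq R).
Proof. by split=> //; apply/negP => /mem_gen0/eqP; rewrite oner_eq0. Qed.

Lemma quotient_proj0 (M : lmodType R) (W : submodClosed M) :
  quotient_proj W 0 = 0.
Proof.
by apply: (addrI (quotient_proj W 0)); rewrite -quotient_projD !addr0.
Qed.

(** A cocycle of degree 0 is a linear form h on the free module on the set R / I
    that vanishes on the relations.  For i in I and any u, the element i *: u is
    a relation since I kills R / I, so i * h u = 0: the values of h lie in the
    annihilator of I. *)
Lemma Ext0_annihilator (I : ideal R) (r : R) :
  (forall e, (forall i, i \in I -> i * e = 0) -> r * e = 0) ->
  annihilator (Ext 0 (quotient_mod I) R^o) r.
Proof.
move=> rI [h hker]; apply: val_inj; apply: val_inj; apply/funext => u /=.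
apply: rI => i Ii.
have lh : linear (submodule_val h) by case: (h) => f /= /asboolP.
have hd x : submodule_val h (@free_res_d R (quotient_mod I) 0 x) = 0.
  by move: hker => /eqP /(congr1 (fun f : Defs.Hom _ _ => submodule_val f x)).
have iu : i *: u \in ker_mem (@free_eval R (quotient_mod I)).
  rewrite /in_mem /= /ker_mem linearZ /= -[free_eval u]quotient_reprK.
  apply/eqP; rewrite [LHS]quotient_scale_proj -quotient_proj0.
  by apply/quotient_projP; rewrite subr0 [_ *: _]mulrC; exact: idealMl.
(* i *: u is the image under the differential of the generator of the next
   free module given by i *: u itself. *)
have hiu := hd << 1 *g Submodule iu >>.
have h0 := hd 0; rewrite linear0 in h0.
have hZ := lh i u 0; rewrite addr0 h0 addr0 in hZ; rewrite -[LHS]hZ.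
by rewrite /free_res_d free_evalU scale1r in hiu.
Qed.

End GeneratedIdeals.

(** * The fibre product of a valuation ring with itself *)

Section FibreProduct.
Variables (K : fieldType) (V : subringClosed K) (t : K).

(** The ideal tV, which is the maximal ideal when t is a uniformizer of V. *)
Definition max_mem : {pred K} := fun x => x / t \in V.

Lemma max_memE x : (x \in max_mem) = (x / t \in V).
Proof. by []. Qed.

Lemma max_memD x y : x \in max_mem -> y \in max_mem -> x + y \in max_mem.
Proof. by rewrite !max_memE mulrDl => xV yV; exact: rpredD. Qed.

Lemma max_memB x y : x \in max_mem -> y \in max_mem -> x - y \in max_mem.
Proof. by rewrite !max_memE mulrBl => xV yV; exact: rpredB. Qed.

Lemma max_mem0 : 0 \in max_mem.
Proof. by rewrite max_memE mul0r rpred0. Qed.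

Lemma max_memMl x y : x \in V -> y \in max_mem -> x * y \in max_mem.
Proof. by rewrite !max_memE -mulrA => xV yV; exact: rpredM. Qed.

Definition fibre_mem : {pred K * K} :=
  fun x => [&& x.1 \in V, x.2 \in V & x.1 - x.2 \in max_mem].

Lemma fibre_mem_closed : subring_closed fibre_mem.
Proof.
split=> [|x y /and3P[x1 x2 x12] /and3P[y1 y2 y12]
         |x y /and3P[x1 x2 x12] /and3P[y1 y2 y12]]; apply/and3P; split => /=.
- exact: rpred1.
- exact: rpred1.
- by rewrite subrr max_mem0.
- exact: rpredB.
- exact: rpredB.
- rewrite (_ : _ - _ = (x.1 - x.2) - (y.1 - y.2)); last by ring.
  exact: max_memB.
- exact: rpredM.
- exact: rpredM.
- rewrite (_ : _ - _ = y.1 * (x.1 - x.2) + x.2 * (y.1 - y.2)); last by ring.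
  by apply: max_memD; exact: max_memMl.
Qed.

HB.instance Definition _ :=
  GRing.isSubringClosed.Build (K * K)%type fibre_mem fibre_mem_closed.

Record fibre := Fibre { fibre_val : K * K; _ : fibre_val \in fibre_mem }.

HB.instance Definition _ := [isSub for fibre_val].
HB.instance Definition _ := [Choice of fibre by <:].
HB.instance Definition _ := [SubChoice_isSubComNzRing of fibre by <:].

Definition pr1 (x : fibre) : K := (fibre_val x).1.
Definition pr2 (x : fibre) : K := (fibre_val x).2.
HB.instance Definition _ := GRing.RMorphism.copy pr1 (fst \o val).
HB.instance Definition _ := GRing.RMorphism.copy pr2 (snd \o val).

Let pr1D : {morph pr1 : x y / x + y}. Proof. exact: rmorphD. Qed.
Let pr1N : {morph pr1 : x / - x}. Proof. exact: rmorphN. Qed.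
Let pr1M : {morph pr1 : x y / x * y}. Proof. exact: rmorphM. Qed.
Let pr1X n : {morph pr1 : x / x ^+ n}. Proof. exact: rmorphXn. Qed.
Let pr1_0 : pr1 0 = 0. Proof. exact: rmorph0. Qed.
Let pr1_1 : pr1 1 = 1. Proof. exact: rmorph1. Qed.
Let pr2D : {morph pr2 : x y / x + y}. Proof. exact: rmorphD. Qed.
Let pr2N : {morph pr2 : x / - x}. Proof. exact: rmorphN. Qed.
Let pr2M : {morph pr2 : x y / x * y}. Proof. exact: rmorphM. Qed.
Let pr2X n : {morph pr2 : x / x ^+ n}. Proof. exact: rmorphXn. Qed.
Let pr2_0 : pr2 0 = 0. Proof. exact: rmorph0. Qed.
Let pr2_1 : pr2 1 = 1. Proof. exact: rmorph1. Qed.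
Let prE := (pr1D, pr1N, pr1M, pr1X, pr1_0, pr1_1,
            pr2D, pr2N, pr2M, pr2X, pr2_0, pr2_1).

Lemma pr_inj x y : pr1 x = pr1 y -> pr2 x = pr2 y -> x = y.
Proof.
move=> xy1 xy2; apply: val_inj => /=.
by rewrite [LHS]surjective_pairing [RHS]surjective_pairing; congr (_, _).
Qed.

Lemma fibreP x : [/\ pr1 x \in V, pr2 x \in V & pr1 x - pr2 x \in max_mem].
Proof. exact/and3P/(valP x). Qed.

Lemma pr1_mem x : pr1 x \in V. Proof. by case: (fibreP x). Qed.
Lemma pr2_mem x : pr2 x \in V. Proof. by case: (fibreP x). Qed.
Lemma pr_sub x : pr1 x - pr2 x \in max_mem. Proof. by case: (fibreP x). Qed.

(** The default 0 is only returned for pairs that are not in the fibre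
    product. *)
Definition pair_fibre (a b : K) : fibre := insubd 0 (a, b).

Lemma pr_pair a b : a \in V -> b \in V -> a - b \in max_mem ->
  pr1 (pair_fibre a b) = a /\ pr2 (pair_fibre a b) = b.
Proof.
move=> aV bV ab; have abR : (a, b) \in fibre_mem by apply/and3P.
by rewrite /pr1 /pr2 /pair_fibre -[fibre_val _]/(val _) insubdK.
Qed.

(** V is a discrete valuation ring with uniformizer t: every nonzero element is
    a power of t times a unit of V. *)
Definition discrete_valuation :=
  [/\ t != 0, t \in V, t^-1 \notin V & forall x, x \in V -> x != 0 ->
    exists2 n, x / t ^+ n \in V & t ^+ n / x \in V].

Hypothesis dv : discrete_valuation.

Let t0 : t != 0. Proof. by case: dv. Qed.
Let tV : t \in V. Proof. by case: dv. Qed.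
Let tinvV : t^-1 \notin V. Proof. by case: dv. Qed.
Let tnV n : t ^+ n \in V. Proof. by apply: rpredX; exact: tV. Qed.
Let tn0 n : t ^+ n != 0. Proof. by rewrite expf_neq0. Qed.

Lemma max_mem_sub x : x \in max_mem -> x \in V.
Proof. by move=> xm; rewrite -(divfK t0 x) rpredM. Qed.

Lemma max_mem_t : t \in max_mem.
Proof. by rewrite max_memE divff // rpred1. Qed.

Lemma max_memX n : t ^+ n.+1 \in max_mem.
Proof. by rewrite max_memE exprS mulrAC divff // mul1r. Qed.

Lemma max_mem1 : 1 \notin max_mem.
Proof. by rewrite max_memE div1r. Qed.

Lemma unit_mem x : x \in V -> x \notin max_mem -> x != 0 /\ x^-1 \in V.
Proof.
move=> xV xm; have x0 : x != 0 by apply: contraNneq xm => ->; exact: max_mem0.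
split=> //; case: dv => _ _ _ /(_ x xV x0)[[|n] xn nx].
  by rewrite expr0 div1r in nx.
case/negP: xm; rewrite max_memE.
rewrite (_ : x / t = x / t ^+ n.+1 * t ^+ n); first by rewrite rpredM.
by rewrite exprS; field; rewrite t0 tn0.
Qed.

(** Any element of least valuation divides all the others; 0 plays this part
    when S has no nonzero element. *)
Lemma min_divisor (S : K -> Prop) : S 0 -> (forall x, S x -> x \in V) ->
  exists2 s, S s & forall x, S x -> exists2 c, c \in V & x = c * s.
Proof.
move=> S0 SV.
have [[x0 [Sx0 x0n0]]|none] := pselect (exists x, S x /\ x != 0); last first.
  exists 0 => // x Sx; exists 0; first exact: rpred0.
  by rewrite mulr0; apply/eqP/negPn/negP => xn0; case: none; exists x.
pose order n x := [/\ S x, x != 0, x / t ^+ n \in V & t ^+ n / x \in V].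
have orderP x : S x -> x != 0 -> exists n, order n x.
  by move=> Sx xn0; case: dv => _ _ _ /(_ x (SV x Sx) xn0)[n]; exists n.
have exn : exists n, `[< exists x, order n x >].
  by have [n] := orderP _ Sx0 x0n0; exists n; apply/asboolP; exists x0.
case: (ex_minnP exn) => n /asboolP[s [Ss sn0 sn ns]] nmin.
exists s => // x Sx; have [->|xn0] := eqVneq x 0.
  by exists 0; [exact: rpred0|rewrite mul0r].
have [k ordk] := orderP _ Sx xn0.
have nk : (n <= k)%N by apply: nmin; apply/asboolP; exists x.
case: ordk => _ _ xk _; exists (x / s); last by rewrite divfK.
rewrite (_ : x / s = x / t ^+ k * t ^+ (k - n) * (t ^+ n / s)).
  exact: rpredM (rpredM xk (tnV _)) ns.
by rewrite -{1}(subnK nk) exprD; field; rewrite sn0 !tn0.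
Qed.

(** An ideal I is in particular a module over the diagonal copy of V.  Take z in
    I whose first coordinate divides that of every element of I, and w dividing
    in the same sense the elements of I whose first coordinate is 0; subtracting
    multiples of z and then of w shows that they generate I. *)
Lemma fibre_noetherian : noetherian fibre.
Proof.
move=> I.
have [||_ [z [Iz <-]] Iz1] := @min_divisor
  (fun a => exists z : fibre, z \in I /\ pr1 z = a).
- by exists 0; rewrite !prE; split=> //; exact: rpred0.
- by move=> _ [z [_ <-]]; exact: pr1_mem.
have [||_ [w [Iw w1 <-]] Iw2] := @min_divisor
  (fun b => exists w : fibre, [/\ w \in I, pr1 w = 0 & pr2 w = b]).
- by exists 0; rewrite !prE; split=> //; exact: rpred0.
- by move=> _ [w [_ _ <-]]; exact: pr2_mem.
exists [:: z; w].
suff main (x : fibre) :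
    (x \in I) = (x \in gen (mem [:: z; w] : {pred fibre^o})).
  by move=> x; exact: main.
apply/idP/idP; last first.
  by apply: gen_sub => y;
    rewrite -[_ \in _]/(y \in [:: z; w]) !inE => /orP[] /eqP ->.
move=> Ix; have [c cV xc] := Iz1 _ (ex_intro _ x (conj Ix erefl)).
have diag a : a \in V -> pr1 (pair_fibre a a) = a /\ pr2 (pair_fibre a a) = a.
  by move=> aV; apply: pr_pair; rewrite // subrr max_mem0.
have [c1 c2] := diag _ cV; set cc := pair_fibre c c in c1 c2.
have [|d dV xd] := Iw2 (pr2 (x - cc * z)).
  exists (x - cc * z); split=> //; last by rewrite !prE c1 -xc subrr.
  by apply: idealB => //; exact: idealMl.
have [d1 d2] := diag _ dV; set dd := pair_fibre d d in d1 d2.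
have -> : x = cc * z + dd * w.
  apply: pr_inj; rewrite !prE /= ?c1 ?d1 ?w1 ?d2 -?xd.
    by rewrite mulr0 addr0.
  by rewrite !prE addrC subrK.
by apply: rpredD; apply: idealMl; apply: sub_gen;
  rewrite -[_ \in _]/(_ \in [:: z; w]) !inE eqxx ?orbT.
Qed.

Definition fibre_max : {pred fibre} := fun x => pr1 x \in max_mem.

Lemma fibre_maxE x : (x \in fibre_max) = (pr1 x \in max_mem).
Proof. by []. Qed.

Lemma fibre_max_pr2 x : (x \in fibre_max) = (pr2 x \in max_mem).
Proof.
rewrite fibre_maxE; apply/idP/idP => xm.
  rewrite (_ : pr2 x = pr1 x - (pr1 x - pr2 x)); last by ring.
  exact: max_memB xm (pr_sub x).
rewrite (_ : pr1 x = pr2 x + (pr1 x - pr2 x)); last by ring.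
exact: max_memD xm (pr_sub x).
Qed.

Lemma fibre_max_closed : idealr_closed fibre_max.
Proof.
split; rewrite ?fibre_maxE ?prE ?max_mem0 ?max_mem1 //.
move=> a u v; rewrite !fibre_maxE !prE => um vm.
exact: max_memD (max_memMl (pr1_mem a) um) vm.
Qed.

HB.instance Definition _ := isIdealr.Build fibre fibre_max fibre_max_closed.

(** Both coordinates are units of V, and their inverses agree modulo t because
    1/a - 1/b = -(a - b)/(ab). *)
Lemma fibre_unit x : x \notin fibre_max -> exists y, y * x = 1.
Proof.
move=> xm; have [x1n0 x1V] := unit_mem (pr1_mem x) xm.
rewrite fibre_max_pr2 in xm; have [x2n0 x2V] := unit_mem (pr2_mem x) xm.
have [|y1 y2] := pr_pair x1V x2V.
  rewrite (_ : _ - _ = - ((pr1 x)^-1 * (pr2 x)^-1) * (pr1 x - pr2 x)).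
    by apply: max_memMl (pr_sub x); rewrite rpredN rpredM.
  by field; rewrite x1n0 x2n0.
exists (pair_fibre (pr1 x)^-1 (pr2 x)^-1).
by apply: pr_inj; rewrite !prE ?y1 ?y2 mulVf.
Qed.

Lemma proper_sub_max (J : idealr fibre) : {subset J <= fibre_max}.
Proof.
move=> x Jx; apply/negPn/negP => /fibre_unit[y yx].
by have := idealMr (idealrI := J) y Jx; rewrite yx idealr1.
Qed.

Lemma fibre_local : local_with fibre_max.
Proof.
split=> [J mJ|m' maxm'] x; first by apply/idP/idP => [/proper_sub_max|/mJ].
by rewrite (maxm' fibre_max) //; exact: proper_sub_max.
Qed.

Definition fibre_min : {pred fibre} := fun x => pr2 x == 0.

Lemma fibre_minE x : (x \in fibre_min) = (pr2 x == 0).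
Proof. by []. Qed.

Lemma fibre_min_closed : idealr_closed fibre_min.
Proof.
split; rewrite ?fibre_minE ?prE ?oner_eq0 //.
move=> a u v; rewrite !fibre_minE !prE => /eqP-> /eqP->.
by rewrite mulr0 addr0.
Qed.

Lemma fibre_min_prime : prime_idealr_closed fibre_min.
Proof. by move=> u v; rewrite !fibre_minE !prE mulf_eq0. Qed.

HB.instance Definition _ := isIdealr.Build fibre fibre_min fibre_min_closed.
HB.instance Definition _ :=
  isPrimeIdealrClosed.Build fibre fibre_min fibre_min_prime.

Lemma fibre_max_prime : prime_idealr_closed fibre_max.
Proof.
move=> u v uv; apply/negPn/negP; rewrite negb_or => /andP[um vm].
have [u' u'u] := fibre_unit um; have [v' v'v] := fibre_unit vm.
have : 1 \in fibre_max.
  rewrite -[1]mulr1 -{1}u'u -v'v mulrACA.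
  exact: (idealMr (idealrI := fibre_max)).
by rewrite (idealr1 fibre_max).
Qed.

HB.instance Definition _ :=
  isPrimeIdealrClosed.Build fibre fibre_max fibre_max_prime.

Lemma pr_pair_max a b : a \in max_mem -> b \in max_mem ->
  pr1 (pair_fibre a b) = a /\ pr2 (pair_fibre a b) = b.
Proof.
by move=> am bm; apply: pr_pair; [apply: max_mem_sub..|apply: max_memB].
Qed.

Definition t_diag := pair_fibre t t.
Let t_diag1 : pr1 t_diag = t.
Proof. by case: (pr_pair_max max_mem_t max_mem_t). Qed.
Let t_diag2 : pr2 t_diag = t.
Proof. by case: (pr_pair_max max_mem_t max_mem_t). Qed.
Definition t_left := pair_fibre t 0.
Let t_left1 : pr1 t_left = t.
Proof. by case: (pr_pair_max max_mem_t max_mem0). Qed.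
Let t_left2 : pr2 t_left = 0.
Proof. by case: (pr_pair_max max_mem_t max_mem0). Qed.
Definition t_right := pair_fibre 0 t.
Let t_right1 : pr1 t_right = 0.
Proof. by case: (pr_pair_max max_mem0 max_mem_t). Qed.
Let t_right2 : pr2 t_right = t.
Proof. by case: (pr_pair_max max_mem0 max_mem_t). Qed.

Lemma sqr_max a : a \in max_mem -> a ^+ 2 / t \in max_mem.
Proof.
move=> am; rewrite expr2 -mulrA mulrC.
by apply: max_memMl.
Qed.

(** If z = (u t ^ i, v t ^ j) with units u and v, then a multiple of z is the
    power (t, t) ^ (i + j + 1), where the extra factor t makes the cofactor an
    element of the ring.  The prime then contains (t, t), which divides the
    square of each element of the maximal ideal. *)
Lemma max_sub_prime (Q : prime_idealr fibre) z :
  z \in Q -> pr1 z != 0 -> pr2 z != 0 -> {subset fibre_max <= Q}.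
Proof.
move=> Qz z1n0 z2n0; case: dv => _ _ _ dvP.
have [i zi iz] := dvP _ (pr1_mem z) z1n0.
have [j zj jz] := dvP _ (pr2_mem z) z2n0.
have [] := @pr_pair_max (t ^+ i / pr1 z * t ^+ j.+1)
  (t ^+ j / pr2 z * t ^+ i.+1).
- by apply: max_memMl; last exact: max_memX.
- by apply: max_memMl; last exact: max_memX.
set y := pair_fibre _ _ => y1 y2.
have Qt : t_diag \in Q.
  apply: (@primeX _ _ _ (i + j).+1).
  suff -> : t_diag ^+ (i + j).+1 = y * z by exact: idealMr.
  apply: pr_inj; rewrite !prE ?t_diag1 ?t_diag2 ?y1 ?y2 /=.
    by rewrite -addnS exprD; field.
  by rewrite addnC -addnS exprD; field.
move=> x xm; have xm2 := xm; rewrite fibre_max_pr2 in xm2.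
have [c1 c2] := pr_pair_max (sqr_max xm) (sqr_max xm2).
apply: (@primeX _ _ _ 2).
rewrite (_ : x ^+ 2 = pair_fibre (pr1 x ^+ 2 / t) (pr2 x ^+ 2 / t) * t_diag).
  exact: idealMr.
by apply: pr_inj; rewrite !prE ?c1 ?c2 ?t_diag1 ?t_diag2 divfK.
Qed.

(** Since (t, 0) * (0, t) = 0, the prime P contains one of the two factors.  If
    z has a zero coordinate, then either adding that factor to z makes both
    coordinates nonzero, or the factor divides z ^ 2, which contradicts that z
    is not in P. *)
Lemma prime_step (P Q : prime_idealr fibre) z :
  {subset P <= Q} -> z \in Q -> z \notin P -> {subset fibre_max <= Q}.
Proof.
move=> PQ Qz Pz.
have zn0 : z != 0 by apply: contraNneq Pz => ->; exact: idealr0.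
have zmax := proper_sub_max Qz.
have zmax2 := zmax; rewrite fibre_max_pr2 in zmax2.
have Pt : (t_left \in P) || (t_right \in P).
  rewrite -prime_idealrM (_ : t_left * t_right = 0) ?idealr0 //.
  by apply: pr_inj; rewrite !prE ?t_left2 ?t_right1 ?mul0r ?mulr0.
have [z1|z1] := eqVneq (pr1 z) 0; have [z2|z2] := eqVneq (pr2 z) 0.
- by case/eqP: zn0; apply: pr_inj; rewrite !prE.
- case/orP: Pt => Pt.
    apply: (@max_sub_prime _ (t_left + z)); first by rewrite rpredD // PQ.
    + by rewrite !prE t_left1 z1 addr0.
    + by rewrite !prE t_left2 add0r.
  case/negP: Pz; apply: (@primeX _ _ _ 2).
  have [c1 c2] := pr_pair_max max_mem0 (sqr_max zmax2).
  rewrite (_ : z ^+ 2 = pair_fibre 0 (pr2 z ^+ 2 / t) * t_right);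
    first exact: idealMr.
  apply: pr_inj; rewrite !prE ?c1 ?c2 ?t_right1 ?t_right2 ?divfK //.
  by rewrite z1.
- case/orP: Pt => Pt; last first.
    apply: (@max_sub_prime _ (t_right + z)); first by rewrite rpredD // PQ.
    + by rewrite !prE t_right1 add0r.
    + by rewrite !prE t_right2 z2 addr0.
  case/negP: Pz; apply: (@primeX _ _ _ 2).
  have [c1 c2] := pr_pair_max (sqr_max zmax) max_mem0.
  rewrite (_ : z ^+ 2 = pair_fibre (pr1 z ^+ 2 / t) 0 * t_left);
    first exact: idealMr.
  apply: pr_inj; rewrite !prE ?c1 ?c2 ?t_left1 ?t_left2 ?divfK //.
  by rewrite z2.
- exact: max_sub_prime Qz z1 z2.
Qed.

Lemma fibre_krull_dim : is_krull_dim fibre 1.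
Proof.
split.
  exists (fun i => if i is 0 then fibre_min : prime_idealr fibre else fibre_max).
  move=> [] //= _.
  split; last exists t_diag;
    rewrite ?fibre_maxE ?fibre_minE ?t_diag1 ?t_diag2 ?max_mem_t //.
  by move=> x /eqP x2; rewrite fibre_max_pr2 x2 max_mem0.
case=> [|[|e]] // P chain.
have [P01 [z P1z P0z]] := chain 0%N isT; have [_ [w P2w]] := chain 1%N isT.
by case/negP; apply: (prime_step P01 P1z P0z); exact: proper_sub_max P2w.
Qed.

(** An element with a zero coordinate is killed by (t, 0) or (0, t). *)
Lemma regular_pr x s : regular_seq (x :: s) -> pr1 x != 0 /\ pr2 x != 0.
Proof.
case=> /(_ 0%N isT) /= reg _.
split; apply/eqP => x0.
- have /mem_gen0/(congr1 pr1) : t_left \in gen (mem [::] : {pred fibre^o}).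
    apply: reg; rewrite (_ : x * t_left = 0); first exact: rpred0.
    by apply: pr_inj; rewrite !prE ?t_left2 ?mulr0 // x0 mul0r.
  by rewrite t_left1 !prE => /eqP; rewrite (negPf t0).
- have /mem_gen0/(congr1 pr2) : t_right \in gen (mem [::] : {pred fibre^o}).
    apply: reg; rewrite (_ : x * t_right = 0); first exact: rpred0.
    by apply: pr_inj; rewrite !prE ?t_right1 ?mulr0 // x0 mul0r.
  by rewrite t_right2 !prE => /eqP; rewrite (negPf t0).
Qed.

(** If x, y were a regular sequence with x = (a, b) and y = (c, d), then
    y * (a, 0) = (c, 0) * x would force (a, 0) to be a multiple of x.  As a and
    b are nonzero, the only candidate for the cofactor is (1, 0), whose
    coordinates differ modulo t. *)
Lemma fibre_depth : is_grade fibre_max 1.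
Proof.
split.
  exists [:: t_diag]; split=> //; last first.
    by move=> x; rewrite inE => /eqP->; rewrite fibre_maxE t_diag1 max_mem_t.
  split=> [[|//] _ r /= /mem_gen0 tr|].
    suff -> : r = 0 by exact: rpred0.
    apply: pr_inj; rewrite !prE; apply: (mulfI t0).
      by rewrite -{1}t_diag1 -?(pr1M, pr2M) tr !prE mulr0.
    by rewrite -{1}t_diag2 -?(pr1M, pr2M) tr !prE mulr0.
  apply/negP => /mem_gen1[c /(congr1 pr1)]; rewrite !prE t_diag1 => c1.
  by case/negP: max_mem1; rewrite c1; apply: max_memMl;
    rewrite ?pr1_mem ?max_mem_t.
case=> [|x [|y s]] // reg sm.
have [x1 x2] := regular_pr reg.
have xm : x \in fibre_max by apply: sm; rewrite inE eqxx.
have ym : y \in fibre_max by apply: sm; rewrite !inE eqxx orbT.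
have [a1 a2] := pr_pair_max xm max_mem0.
have [b1 b2] := pr_pair_max ym max_mem0.
case: reg => /(_ 1%N isT (pair_fibre (pr1 x) 0)) /= reg _.
have /mem_gen1[c cx] :
    pair_fibre (pr1 x) 0 \in gen (mem [:: x] : {pred fibre^o}).
  apply: reg; rewrite (_ : y * _ = pair_fibre (pr1 y) 0 * x).
    by apply: idealMl; apply: sub_gen; rewrite inE.
  by apply: pr_inj; rewrite !prE ?a1 ?a2 ?b1 ?b2 ?mulr0 ?mul0r.
have c1 : pr1 c = 1.
  by apply: (mulIf x1); rewrite -?(pr1M, pr2M) -cx a1 mul1r.
have c2 : pr2 c = 0.
  by apply: (mulIf x2); rewrite -?(pr1M, pr2M) -cx a2 mul0r.
by have := pr_sub c; rewrite c1 c2 subr0 (negPf max_mem1).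
Qed.

Lemma fibre_CM : cohen_macaulay_local fibre.
Proof.
split; first exact: fibre_noetherian.
exists fibre_max; first exact: fibre_local.
by exists 1%N; split; [exact: fibre_krull_dim|exact: fibre_depth].
Qed.

(** * The square of a minimal prime *)

Definition min_sqr : ideal fibre := ideal_pow fibre_min 2.

Lemma min_sqr_sub : {subset min_sqr <= fibre_min}.
Proof. exact: (@ideal_pow_sub _ fibre_min 2). Qed.

Lemma min_sqr_grade : is_grade min_sqr 0.
Proof.
split; first by exists [::]; split=> //; exact: regular_seq_nil.
case=> // x s /regular_pr[_ x2] sI.
have /min_sqr_sub : x \in min_sqr by apply: sI; rewrite inE eqxx.
by rewrite fibre_minE (negPf x2).
Qed.

(** If (t ^ 2, 0) kills e, then e has first coordinate 0. *)
Lemma t_left_in_D : D min_sqr t_left.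
Proof.
exists 0%N; first exact: min_sqr_grade.
apply: Ext0_annihilator => e eI.
have : t_left * t_left \in min_sqr.
  apply: sub_gen; apply/asboolP; exists (fun=> t_left); last first.
    by rewrite !big_ord_recl big_ord0 mulr1.
  by move=> _; rewrite fibre_minE t_left2.
move/eI => te; apply: pr_inj; rewrite !prE ?t_left2 ?mul0r // t_left1.
by apply: (mulfI t0); rewrite mulrA -t_left1 -!pr1M te pr1_0 mulr0.
Qed.

Definition pr1_order n : {pred fibre^o} := fun x => pr1 x / t ^+ n \in V.

Lemma pr1_order_closed n : subsemimod_closed (pr1_order n).
Proof.
split; first split.
- by rewrite /in_mem /= /pr1_order pr1_0 mul0r rpred0.
- by move=> x y xn yn; rewrite /in_mem /= /pr1_order pr1D mulrDl; exact: rpredD.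
- move=> a x xn; rewrite /in_mem /= /pr1_order pr1M -mulrA.
  by apply: rpredM xn; exact: pr1_mem.
Qed.

HB.instance Definition _ n :=
  GRing.isSubmodClosed.Build fibre fibre^o (pr1_order n) (pr1_order_closed n).

Lemma ideal_pow_order (J : {pred fibre}) k n :
  {subset J <= pr1_order k} -> {subset ideal_pow J n <= pr1_order (k * n)}.
Proof.
move=> Jk; apply: (@gen_sub _ _ _ (pr1_order (k * n))) => _ /asboolP[a Ja ->].
rewrite /in_mem /= /pr1_order rmorph_prod /= exprM.
rewrite -[n in _ ^+ n]card_ord -prodr_const -prodf_div.
by apply: rpred_prod => i _; exact/Jk/Ja.
Qed.

Lemma min_sqr_order : {subset min_sqr <= pr1_order 2}.
Proof.
apply: (@ideal_pow_order _ 1) => x; rewrite fibre_minE => /eqP x2.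
by rewrite /in_mem /= /pr1_order expr1 -[pr1 x]subr0 -x2; exact: pr_sub.
Qed.

(** In first coordinates the i-th coefficient is divisible by t ^ (2 * i), so
    its term is divisible by t ^ (n + i), and i > 0; dividing the equation by
    t ^ n.+1 would put t^-1 in V. *)
Lemma t_left_not_integral : ~ integral_closure min_sqr t_left.
Proof.
case=> n [a [n0 aI /(congr1 pr1)]].
rewrite pr1D pr1X pr1_0 t_left1 => /eqP; rewrite addr_eq0 => /eqP tn.
case/negP: tinvV; have -> : t^-1 = t ^+ n / t ^+ n.+1.
  by rewrite exprS; field; rewrite t0 tn0.
rewrite {1}tn -pr1N -sumrN rmorph_sum mulr_suml big_nat.
apply: rpred_sum => i /andP[i0 ilen] /=.
rewrite pr1N pr1M pr1X t_left1.
have /(ideal_pow_order min_sqr_order) ai : a i \in ideal_pow min_sqr i.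
  by apply: aI; rewrite i0.
rewrite (_ : _ / _ = - (pr1 (a i) / t ^+ (2 * i) * t ^+ i.-1)).
  by rewrite rpredN; exact: rpredM ai (tnV _).
rewrite (_ : n.+1 = (n - i) + i.+1)%N; last by lia.
rewrite (_ : 2 * i = i.+1 + i.-1)%N; last by lia.
by rewrite !exprD; field; rewrite !tn0.
Qed.

End FibreProduct.

(** * The integers localized at two *)

Definition Z2_mem : {pred rat} :=
  fun x => `[< exists (a : int) (d : nat), odd d /\ x = a%:~R / d%:R >].

Lemma odd_neq0 (d : nat) : odd d -> d%:R != 0 :> rat.
Proof. by move=> dodd; rewrite pnatr_eq0; case: d dodd. Qed.

Lemma Z2_closed : subring_closed Z2_mem.
Proof.
split.
- by apply/asboolP; exists 1, 1%N; rewrite divr1.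
- move=> _ _ /asboolP[a [d [dodd ->]]] /asboolP[b [e [eodd ->]]].
  apply/asboolP; exists (a * e%:Z - b * d%:Z), (d * e)%N.
  rewrite oddM dodd eodd; split=> //.
  rewrite natrM rmorphB !rmorphM /= -!pmulrn.
  by field; rewrite !odd_neq0.
- move=> _ _ /asboolP[a [d [dodd ->]]] /asboolP[b [e [eodd ->]]].
  apply/asboolP; exists (a * b), (d * e)%N.
  rewrite oddM dodd eodd; split=> //.
  rewrite natrM rmorphM /=.
  by field; rewrite !odd_neq0.
Qed.

HB.instance Definition _ := GRing.isSubringClosed.Build rat Z2_mem Z2_closed.

Lemma Z2_dv : discrete_valuation Z2_mem 2%:R.
Proof.
split=> //; first exact: rpred_nat.
  apply/negP => /asboolP[a [d [dodd half]]].
  have ad : a * 2%:Z = d%:Z.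
    apply: (@intr_inj rat); rewrite rmorphM /= -(divfK (odd_neq0 dodd) a%:~R).
    by rewrite -half mulrAC mulVf // mul1r.
  by move/(congr1 (fun x : int => odd `|x|)): ad; rewrite abszM oddM andbF dodd.
move=> _ /asboolP[a [d [dodd ->]]] xn0.
have a0 : (0 < `|a|)%N.
  by rewrite absz_gt0; apply: contraNneq xn0 => ->; rewrite mul0r.
have [m] := pfactor_coprime (isT : prime 2) a0.
set n := logn 2 _; rewrite coprime2n => modd am.
(* a = s * m * 2 ^ n with s a sign and m odd. *)
have {am} -> : a = (-1) ^+ (a < 0)%R * m%:Z * 2%:Z ^+ n.
  by rewrite [LHS]intEsign am PoszM mulrA -[Posz (2 ^ n)]natz natrX natz.
set s : int := (-1) ^+ (a < 0)%R.
have sV : s%:~R^-1 = s%:~R :> rat by rewrite /s rmorph_sign invr_sign.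
have s0 : s%:~R != 0 :> rat by rewrite intr_eq0 signr_eq0.
have d0 := odd_neq0 dodd; have m0 := odd_neq0 modd.
have n0 : 2%:R ^+ n != 0 :> rat by rewrite expf_neq0.
exists n; apply/asboolP.
  exists (s * m%:Z), d; split=> //.
  by rewrite !rmorphM rmorphXn /= -!pmulrn; field; rewrite n0 d0.
exists (s * d%:Z), m; split=> //.
rewrite !rmorphM rmorphXn /= -[in RHS]sV -!pmulrn.
by field; rewrite n0 d0 m0 s0.
Qed.

Theorem corollary3p11 :
  exists (R : comNzRingType) (I : ideal R),
    [/\ cohen_macaulay_local R, prime_power I & ~ (D I `<=` integral_closure I)].
Proof.
exists (fibre Z2_mem 2%:R), (min_sqr Z2_mem 2%:R); split.
- exact: fibre_CM Z2_dv.
- by exists (@fibre_min _ Z2_mem 2%:R), 2%N.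
- by move=> /(_ _ (t_left_in_D Z2_dv)) /(t_left_not_integral Z2_dv).
Qed.
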